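(* Let $n\ge1$, let $\mathcal T$ be a triangulated category and let $\mathcal X=\operatorname{add}\mathcal X$ be a functorially finite subcategory satisfying $\mathcal T(X,X'[i])=0$ for all $X,X'\in\mathcal X$ and $1\le i\le n$. Equip $\mathcal T/[\mathcal X]$ with its canonical pretriangulated structure. Then the following are equivalent: (1) $\mathcal X$ is an $(n+1)$ cluster tilting subcategory of $\mathcal T$; (2) $\mathcal T/[\mathcal X]$ is $n$-truncated; (3) $\Sigma_{\mathcal X}^n\cong\mathbf 0$; (4) $\Omega_{\mathcal X}^n\cong\mathbf 0$. Moreover, for every $A\in\mathcal T$ (whether or not these conditions hold): $$A\in\mathcal X\iff\Big(\mathcal T(X,A[i])=0\ \text{ for all }X\in\mathcal X,\ 1\le i\le n,\ \text{ and }\ \Sigma_{\mathcal X}^n(\pi_{\mathcal X}A)\cong0\Big),$$ and $$A\in\mathcal X\iff\Big(\mathcal T(A,X[i])=0\ \text{ for all }X\in\mathcal X,\ 1\le i\le n,\ \text{ and }\ \Omega_{\mathcal X}^n(\pi_{\mathcal X}A)\cong0\Big).$$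
   Context: Subcategories are full and closed under isomorphisms; $\mathcal X=\operatorname{add}\mathcal X$ means closed under finite direct sums and direct summands. $[1]$ is the shift of $\mathcal T$. $\mathcal X$ is functorially finite if every $A\in\mathcal T$ admits a left $\mathcal X$-approximation (a morphism $A\to X_A$, $X_A\in\mathcal X$, through which every morphism from $A$ to an object of $\mathcal X$ factors) and, dually, a right $\mathcal X$-approximation $X^A\to A$. $\mathcal X$ is $(n+1)$ cluster tilting if it is functorially finite and $$\mathcal X=\{A\mid\mathcal T(A,X[i])=0\ \forall X\in\mathcal X,\ 1\le i\le n\}=\{A\mid\mathcal T(X,A[i])=0\ \forall X\in\mathcal X,\ 1\le i\le n\}.$$ $\mathcal T/[\mathcal X]$ is the ideal quotient by the morphisms factoring through objects of $\mathcal X$, with quotient functor $\pi_{\mathcal X}$. Its canonical pretriangulated structure has suspension $\Sigma_{\mathcal X}$ given by $\Sigma_{\mathcal X}(\pi_{\mathcal X}A)=\pi_{\mathcal X}(A^+)$, where $A\to X_A\to A^+\to A[1]$ is a chosen distinguished triangle whose first morphism is a left $\mathcal X$-approximation (on morphisms: complete $f:A\to B$ to a morphism $(f,g,h)$ of the chosen triangles and take $\pi_{\mathcal X}h$), and loop $\Omega_{\mathcal X}$ defined dually from distinguished triangles $A^-\to X^A\to A\to A^-[1]$ whose second morphism is a right $\mathcal X$-approximation; $\Sigma_{\mathcal X}$ is left adjoint to $\Omega_{\mathcal X}$. $\mathbf 0$ is the zero endofunctor. A pretriangulated category with suspension $\Sigma$ and loop $\Omega$ is $n$-truncated if $\Sigma^n\cong\mathbf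 0$, equivalently $\Omega^n\cong\mathbf 0$. *)

(* Defs.v *)
From HB Require Import structures.
From mathcomp Require Import all_boot all_algebra.
From mathcomp Require Import boolp.

Set Implicit Arguments.
Unset Strict Implicit.
Unset Printing Implicit Defensive.

Import GRing.Theory.
Local Open Scope ring_scope.
Local Open Scope quotient_scope.

Record preadditive := Preadditive {
  obj :> Type;
  arrow : obj -> obj -> zmodType;
  ident : forall A, arrow A A;
  compm : forall A B C, arrow B C -> arrow A B -> arrow A C;
  comp_idl : forall A B (f : arrow A B), compm (ident B) f = f;
  comp_idr : forall A B (f : arrow A B), compm f (ident A) = f;
  comp_assoc : forall A B C D (h : arrow C D) (g : arrow B C) (f : arrow A B),
    compm h (compm g f) = compm (compm h g) f;
  compDl : forall A B C (g g' : arrow B C) (f : arrow A B),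
    compm (g + g') f = compm g f + compm g' f;
  compDr : forall A B C (g : arrow B C) (f f' : arrow A B),
    compm g (f + f') = compm g f + compm g f' }.

Arguments arrow {p} A B.
Arguments ident {p} A.
Arguments compm {p A B C} g f.

Notation "g \oc f" := (compm g f) (at level 40, left associativity).

Definition is_iso (C : preadditive) (A B : C) (f : arrow A B) : Prop :=
  exists g : arrow B A, g \oc f = ident A /\ f \oc g = ident B.

Definition isomorphic (C : preadditive) (A B : C) : Prop :=
  exists f : arrow A B, is_iso f.

Definition is_biproduct (C : preadditive) (A B S : C)
    (i1 : arrow A S) (i2 : arrow B S) (p1 : arrow S A) (p2 : arrow S B) :
    Prop :=
  [/\ p1 \oc i1 = ident A, p2 \oc i2 = ident B,
      p2 \oc i1 = 0, p1 \oc i2 = 0 & i1 \oc p1 + i2 \oc p2 = ident S].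

Definition biproduct (C : preadditive) (A B S : C) : Prop :=
  exists (i1 : arrow A S) (i2 : arrow B S) (p1 : arrow S A) (p2 : arrow S B),
    is_biproduct i1 i2 p1 p2.

Record additive := Additive {
  add_base :> preadditive;
  zobj : add_base;
  zobj_id : ident zobj = 0;
  biproduct_exists : forall A B : add_base, exists S, biproduct A B S }.

Arguments zobj {C} : rename.

(* Functors are additive. *)
Record functor (C D : preadditive) := Functor {
  fobj :> C -> D;
  fmap : forall A B, arrow A B -> arrow (fobj A) (fobj B);
  fmap_id : forall A, fmap (ident A) = ident (fobj A);
  fmap_comp : forall A B E (g : arrow B E) (f : arrow A B),
    fmap (g \oc f) = fmap g \oc fmap f;
  fmapD : forall A B (f g : arrow A B), fmap (f + g) = fmap f + fmap g }.

Arguments fmap {C D} F {A B} f : rename.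

Definition id_functor (C : preadditive) : functor C C :=
  @Functor C C (fun A => A) (fun A B f => f) (fun=> erefl)
    (fun _ _ _ _ _ => erefl) (fun _ _ _ _ => erefl).

Section FunctorComposition.
Variables (C D E : preadditive) (G : functor D E) (F : functor C D).

Fact comp_functor_id A : fmap G (fmap F (ident A)) = ident (G (F A)).
Proof. by rewrite !fmap_id. Qed.

Fact comp_functor_comp A B B' (g : arrow B B') (f : arrow A B) :
  fmap G (fmap F (g \oc f)) = fmap G (fmap F g) \oc fmap G (fmap F f).
Proof. by rewrite !fmap_comp. Qed.

Fact comp_functorD A B (f g : arrow A B) :
  fmap G (fmap F (f + g)) = fmap G (fmap F f) + fmap G (fmap F g).
Proof. by rewrite !fmapD. Qed.

Definition comp_functor : functor C E :=
  @Functor C E (fun A => G (F A)) (fun A B f => fmap G (fmap F f))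
    comp_functor_id comp_functor_comp comp_functorD.
End FunctorComposition.

Fixpoint iter_functor (C : preadditive) (n : nat) (F : functor C C) :
    functor C C :=
  if n is m.+1 then comp_functor F (iter_functor m F) else id_functor C.

Section ZeroFunctor.
Variable C : additive.

Definition zero_functor : functor C C :=
  @Functor C C (fun=> zobj) (fun A B f => 0) (fun=> esym (@zobj_id C))
    (fun _ _ _ _ _ => etrans (esym (comp_idl 0))
       (congr1 (fun u => u \oc (0 : arrow zobj zobj)) (@zobj_id C)))
    (fun _ _ _ _ => esym (addr0 0)).
End ZeroFunctor.

Definition natural_iso (C D : preadditive) (F G : functor C D) : Prop :=
  exists eta : forall A : C, arrow (F A) (G A),
    (forall A, is_iso (eta A)) /\
    (forall A B (f : arrow A B), fmap G f \oc eta A = eta B \oc fmap F f).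

(* F is left adjoint to G. *)
Definition adjoint (C D : preadditive) (F : functor C D) (G : functor D C) :
    Prop :=
  exists phi : forall (A : C) (B : D), arrow (F A) B -> arrow A (G B),
    [/\ forall A B, bijective (phi A B),
        forall A A' B (a : arrow A' A) (x : arrow (F A) B),
          phi A' B (x \oc fmap F a) = phi A B x \oc a
      & forall A B B' (b : arrow B B') (x : arrow (F A) B),
          phi A B' (b \oc x) = fmap G b \oc phi A B x].

Record triangle (C : preadditive) (S : functor C C) := Triangle {
  vtx1 : C; vtx2 : C; vtx3 : C;
  mor1 : arrow vtx1 vtx2;
  mor2 : arrow vtx2 vtx3;
  mor3 : arrow vtx3 (S vtx1) }.

Arguments Triangle {C} S {vtx1 vtx2 vtx3} mor1 mor2 mor3.

Definition triangle_mor (C : preadditive) (S : functor C C)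
    (t t' : triangle S) (f : arrow (vtx1 t) (vtx1 t'))
    (g : arrow (vtx2 t) (vtx2 t')) (h : arrow (vtx3 t) (vtx3 t')) : Prop :=
  [/\ g \oc mor1 t = mor1 t' \oc f,
      h \oc mor2 t = mor2 t' \oc g
    & fmap S f \oc mor3 t = mor3 t' \oc h].

Definition rotate (C : preadditive) (S : functor C C) (t : triangle S) :
    triangle S :=
  Triangle S (mor2 t) (mor3 t) (- fmap S (mor1 t)).

(* The shift is an autoequivalence, not necessarily an automorphism. *)
Record triangulated := Triangulated {
  tri_base :> additive;
  shift : functor tri_base tri_base;
  shift_ff : forall A B : tri_base, bijective (@fmap _ _ shift A B);
  shift_es : forall B : tri_base, exists A, isomorphic (shift A) B;
  distinguished : triangle shift -> Prop;
  dist_iso : forall (t t' : triangle shift)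
      (f : arrow (vtx1 t) (vtx1 t')) (g : arrow (vtx2 t) (vtx2 t'))
      (h : arrow (vtx3 t) (vtx3 t')),
    triangle_mor f g h -> is_iso f -> is_iso g -> is_iso h ->
    distinguished t -> distinguished t';
  dist_id : forall A : tri_base,
    distinguished (@Triangle _ shift A A zobj (ident A) 0 0);
  dist_cone : forall (A B : tri_base) (f : arrow A B),
    exists (C : tri_base) (g : arrow B C) (h : arrow C (shift A)),
      distinguished (Triangle shift f g h);
  dist_rotate : forall t : triangle shift,
    distinguished t <-> distinguished (rotate t);
  dist_fill : forall t t' : triangle shift,
    distinguished t -> distinguished t' ->
    forall (f : arrow (vtx1 t) (vtx1 t')) (g : arrow (vtx2 t) (vtx2 t')),
      g \oc mor1 t = mor1 t' \oc f ->
      exists h : arrow (vtx3 t) (vtx3 t'), triangle_mor f g h;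
  dist_octahedron : forall (A B C Cf Cg Cgf : tri_base)
      (f : arrow A B) (f' : arrow B Cf) (f'' : arrow Cf (shift A))
      (g : arrow B C) (g' : arrow C Cg) (g'' : arrow Cg (shift B))
      (k' : arrow C Cgf) (k'' : arrow Cgf (shift A)),
    distinguished (Triangle shift f f' f'') ->
    distinguished (Triangle shift g g' g'') ->
    distinguished (Triangle shift (g \oc f) k' k'') ->
    exists (u : arrow Cf Cgf) (v : arrow Cgf Cg),
      [/\ distinguished (Triangle shift u v (fmap shift f' \oc g'')),
          u \oc f' = k' \oc g, k'' \oc u = f'',
          v \oc k' = g' & g'' \oc v = fmap shift f \oc k''] }.

Arguments shift {T} : rename.
Arguments distinguished {T} t : rename.

(* A full subcategory closed under isomorphisms, finite direct sums (the empty
   sum included) and direct summands. *)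
Record add_subcategory (C : additive) := AddSubcategory {
  in_sub :> C -> Prop;
  sub_iso : forall A B, isomorphic A B -> in_sub A -> in_sub B;
  sub_zero : in_sub zobj;
  sub_sum : forall A B S, biproduct A B S -> in_sub A -> in_sub B -> in_sub S;
  sub_summand : forall A B S, biproduct A B S -> in_sub S -> in_sub A }.

Section Approximation.
Variables (C : additive) (X : add_subcategory C).

Definition left_approximation (A XA : C) (f : arrow A XA) : Prop :=
  X XA /\ forall Y, X Y ->
    forall g : arrow A Y, exists h : arrow XA Y, g = h \oc f.

Definition right_approximation (A XA : C) (f : arrow XA A) : Prop :=
  X XA /\ forall Y, X Y ->
    forall g : arrow Y A, exists h : arrow Y XA, g = f \oc h.

Definition functorially_finite : Prop :=
  forall A : C,
    (exists (XA : C) (f : arrow A XA), left_approximation f) /\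
    (exists (XA : C) (f : arrow XA A), right_approximation f).
End Approximation.

Definition shiftn (T : triangulated) (i : nat) : functor T T :=
  iter_functor i shift.

(* m cluster tilting; the degrees are 1 <= i <= m - 1. *)
Definition cluster_tilting (T : triangulated) (m : nat)
    (X : add_subcategory T) : Prop :=
  [/\ functorially_finite X,
      forall A : T, X A <->
        (forall Y, X Y -> forall i, (0 < i < m)%N ->
           forall f : arrow A (shiftn T i Y), f = 0)
    & forall A : T, X A <->
        (forall Y, X Y -> forall i, (0 < i < m)%N ->
           forall f : arrow Y (shiftn T i A), f = 0)].

Section PreadditiveTheory.
Variable C : preadditive.

Lemma comp0l (A B D : C) (f : arrow A B) : (0 : arrow B D) \oc f = 0.
Proof. by apply: (addrI (0 \oc f)); rewrite -compDl !addr0. Qed.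

Lemma comp0r (A B D : C) (g : arrow B D) : g \oc (0 : arrow A B) = 0.
Proof. by apply: (addrI (g \oc 0)); rewrite -compDr !addr0. Qed.

Lemma compNl (A B D : C) (g : arrow B D) (f : arrow A B) :
  (- g) \oc f = - (g \oc f).
Proof. by apply: (addrI (g \oc f)); rewrite -compDl !subrr comp0l. Qed.

Lemma compNr (A B D : C) (g : arrow B D) (f : arrow A B) :
  g \oc (- f) = - (g \oc f).
Proof. by apply: (addrI (g \oc f)); rewrite -compDr !subrr comp0r. Qed.
End PreadditiveTheory.

Lemma fmap0 (C D : preadditive) (F : functor C D) (A B : C) :
  fmap F (0 : arrow A B) = 0.
Proof. by apply: (addrI (fmap F 0)); rewrite -fmapD !addr0. Qed.

Lemma fmapN (C D : preadditive) (F : functor C D) (A B : C) (f : arrow A B) :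
  fmap F (- f) = - fmap F f.
Proof. by apply: (addrI (fmap F f)); rewrite -fmapD !subrr fmap0. Qed.

Lemma hom_to_zobj (C : additive) (A : C) (f : arrow A zobj) : f = 0.
Proof. by rewrite -[f]comp_idl zobj_id comp0l. Qed.

Lemma hom_from_zobj (C : additive) (A : C) (f : arrow zobj A) : f = 0.
Proof. by rewrite -[f]comp_idr zobj_id comp0r. Qed.

Section IdealQuotient.
Variables (C : additive) (X : add_subcategory C).

Definition factors_through (A B : C) (f : arrow A B) : Prop :=
  exists2 Z, X Z & exists (u : arrow A Z) (v : arrow Z B), f = v \oc u.

Definition ideal (A B : C) : {pred arrow A B} :=
  fun f => `[< factors_through f >].

Lemma idealP A B (f : arrow A B) :
  reflect (factors_through f) (f \in @ideal A B).
Proof. exact: asboolP. Qed.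

Lemma ideal_compl A B D (g : arrow B D) (f : arrow A B) :
  f \in @ideal A B -> g \oc f \in @ideal A D.
Proof.
move=> /idealP[Z XZ [u [v ->]]]; apply/idealP; exists Z => //.
by exists u, (g \oc v); rewrite comp_assoc.
Qed.

Lemma ideal_compr A B D (g : arrow B D) (f : arrow A B) :
  g \in @ideal B D -> g \oc f \in @ideal A D.
Proof.
move=> /idealP[Z XZ [u [v ->]]]; apply/idealP; exists Z => //.
by exists (u \oc f), v; rewrite comp_assoc.
Qed.

Fact ideal_zmod_closed A B : zmod_closed (@ideal A B).
Proof.
split.
  by apply/idealP; exists zobj; [exact: sub_zero|exists 0, 0; rewrite comp0l].
move=> f g /idealP[Z XZ [u [v ->]]] /idealP[Z' XZ' [u' [v' ->]]].
have [S bip] := biproduct_exists Z Z'.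
have XS := sub_sum bip XZ XZ'.
case: bip => i1 [i2 [p1 [p2 [e11 e22 e21 e12 _]]]].
apply/idealP; exists S => //.
exists (i1 \oc u + i2 \oc u'), (v \oc p1 - v' \oc p2).
rewrite compDl !compDr !compNl.
rewrite -!comp_assoc (comp_assoc p1 i1) (comp_assoc p1 i2).
rewrite (comp_assoc p2 i1) (comp_assoc p2 i2) e11 e22 e21 e12.
by rewrite !comp_idl !comp0l !comp0r addr0 oppr0 add0r.
Qed.

HB.instance Definition _ A B :=
  GRing.isZmodClosed.Build (arrow A B) (@ideal A B) (ideal_zmod_closed A B).

Definition qhom (A B : C) : zmodType :=
  Quotient.quot (GRing.ZmodClosed.clone (arrow A B) (@ideal A B) _).

Definition qpi (A B : C) (f : arrow A B) : qhom A B := \pi f.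

Lemma qpiP A B (f g : arrow A B) : qpi f = qpi g <-> f - g \in @ideal A B.
Proof.
rewrite Quotient.idealrBE; split; first by move/eqP.
by move/eqP.
Qed.

Lemma qpi0P A B (f : arrow A B) : qpi f = 0 <-> f \in @ideal A B.
Proof. by rewrite -[0](raddf0 (\pi_(qhom A B))) -/(qpi 0) qpiP subr0. Qed.

Lemma qpiD A B (f g : arrow A B) : qpi (f + g) = qpi f + qpi g.
Proof. exact: (raddfD (\pi_(qhom A B))). Qed.

Lemma qpiB A B (f g : arrow A B) : qpi (f - g) = qpi f - qpi g.
Proof. exact: (raddfB (\pi_(qhom A B))). Qed.

Lemma qpi_repr A B (x : qhom A B) : qpi (repr x) = x.
Proof. exact: reprK. Qed.

Definition qcomp (A B D : C) (y : qhom B D) (x : qhom A B) : qhom A D :=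
  qpi (repr y \oc repr x).

Lemma qcompE A B D (g : arrow B D) (f : arrow A B) :
  qcomp (qpi g) (qpi f) = qpi (g \oc f).
Proof.
apply/qpiP; set g' := repr _; set f' := repr _.
have -> : g' \oc f' - g \oc f = (g' - g) \oc f' + g \oc (f' - f).
  by rewrite compDl compDr compNl compNr addrA subrK.
have Hg : g' - g \in @ideal B D by apply/qpiP; rewrite qpi_repr.
have Hf : f' - f \in @ideal A B by apply/qpiP; rewrite qpi_repr.
by apply: rpredD; [exact: ideal_compr | exact: ideal_compl].
Qed.

Fact qcomp_idl A B (x : qhom A B) : qcomp (qpi (ident B)) x = x.
Proof. by rewrite -[x]qpi_repr qcompE comp_idl. Qed.

Fact qcomp_idr A B (x : qhom A B) : qcomp x (qpi (ident A)) = x.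
Proof. by rewrite -[x]qpi_repr qcompE comp_idr. Qed.

Fact qcomp_assoc A B D E (z : qhom D E) (y : qhom B D) (x : qhom A B) :
  qcomp z (qcomp y x) = qcomp (qcomp z y) x.
Proof.
by rewrite -[x]qpi_repr -[y]qpi_repr -[z]qpi_repr !qcompE comp_assoc.
Qed.

Fact qcompDl A B D (y y' : qhom B D) (x : qhom A B) :
  qcomp (y + y') x = qcomp y x + qcomp y' x.
Proof.
rewrite -[x]qpi_repr -[y]qpi_repr -[y']qpi_repr -qpiD !qcompE.
by rewrite compDl qpiD.
Qed.

Fact qcompDr A B D (y : qhom B D) (x x' : qhom A B) :
  qcomp y (x + x') = qcomp y x + qcomp y x'.
Proof.
rewrite -[x]qpi_repr -[y]qpi_repr -[x']qpi_repr -qpiD !qcompE.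
by rewrite compDr qpiD.
Qed.

Definition quotient_preadditive : preadditive :=
  @Preadditive C qhom (fun A => qpi (ident A)) qcomp
    qcomp_idl qcomp_idr qcomp_assoc qcompDl qcompDr.

Definition qproj : functor C quotient_preadditive :=
  @Functor C quotient_preadditive (fun A => A) (fun A B f => qpi f)
    (fun=> erefl) (fun _ _ _ g f => esym (qcompE g f)) qpiD.

Fact quotient_zobj_id : ident (zobj : quotient_preadditive) = 0.
Proof. by apply/qpi0P; rewrite zobj_id rpred0. Qed.

Fact quotient_biproduct (A B : quotient_preadditive) :
  exists S : quotient_preadditive, biproduct A B S.
Proof.
have [S [i1 [i2 [p1 [p2 [e11 e22 e21 e12 e]]]]]] := @biproduct_exists C A B.
exists S, (fmap qproj i1), (fmap qproj i2), (fmap qproj p1), (fmap qproj p2).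
split.
- by rewrite /= qcompE e11.
- by rewrite /= qcompE e22.
- by rewrite /= qcompE e21; apply/qpi0P; exact: rpred0.
- by rewrite /= qcompE e12; apply/qpi0P; exact: rpred0.
- by rewrite /= !qcompE -qpiD e.
Qed.

(* C/[X], with C's objects *)
Definition quotient_category : additive :=
  @Additive quotient_preadditive zobj quotient_zobj_id quotient_biproduct.

Definition quotient_functor : functor C quotient_category := qproj.
End IdealQuotient.

Section TriangulatedTheory.
Variable T : triangulated.
Implicit Types t : triangle (@shift T).

Lemma shift_inj (A B : T) : injective (@fmap _ _ (@shift T) A B).
Proof. exact: bij_inj (shift_ff A B). Qed.

Lemma shift_full (A B : T) (k : arrow (shift A) (shift B)) :
  exists f : arrow A B, k = fmap shift f.
Proof. by have [g _ gK] := shift_ff A B; exists (g k); rewrite gK. Qed.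

Lemma dist_comp21 t : distinguished t -> mor2 t \oc mor1 t = 0.
Proof.
move=> dt.
have [|h [_ /= e _]] :=
  dist_fill (dist_id (vtx1 t)) dt (f := ident _) (g := mor1 t).
  by [].
by rewrite -e comp0r.
Qed.

Lemma dist_comp32 t : distinguished t -> mor3 t \oc mor2 t = 0.
Proof. by move=> /dist_rotate /dist_comp21. Qed.

Lemma dist_comp13 t : distinguished t -> fmap shift (mor1 t) \oc mor3 t = 0.
Proof.
move=> /dist_rotate /dist_comp32 /= /eqP.
by rewrite compNl oppr_eq0 => /eqP.
Qed.

Lemma dist_exact t (W : T) (k : arrow W (vtx2 t)) :
  distinguished t -> mor2 t \oc k = 0 ->
  exists l : arrow W (vtx1 t), k = mor1 t \oc l.
Proof.
move=> dt e.
have dW := (dist_rotate _).1 (dist_id W).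
have [|c [_ _ /= e3]] := dist_fill dW ((dist_rotate _).1 dt) (f := k) (g := 0).
  by rewrite /= comp0l e.
have [l lc] := shift_full c; exists l; apply: shift_inj.
rewrite fmap_comp -lc; apply: oppr_inj.
by rewrite -compNl -e3 compNr fmap_id comp_idr.
Qed.

Lemma dist_coexact t (W : T) (k : arrow (vtx2 t) W) :
  distinguished t -> k \oc mor1 t = 0 ->
  exists l : arrow (vtx3 t) W, k = l \oc mor2 t.
Proof.
move=> dt e.
have [D [g [h dW]]] := dist_cone (0 : arrow zobj W).
have h0 : h = 0.
  rewrite -[h]comp_idl -fmap_id zobj_id fmap0.
  by rewrite comp0l.
have [|r /= er] :=
  @dist_exact (rotate (Triangle shift 0 g h)) D (ident D) ((dist_rotate _).1 dW).
  by rewrite /= h0 comp0l.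
have rg : r \oc g = ident W.
  apply/eqP; rewrite -subr_eq0; apply/eqP.
  have [|l ->] := @dist_exact (Triangle shift 0 g h) W (r \oc g - ident W) dW.
    by rewrite /= compDr compNr comp_idr comp_assoc -er comp_idl subrr.
  by rewrite /= comp0l.
have [|c [_ /= ec _]] := dist_fill dt dW (f := 0) (g := k).
  by rewrite /= e comp0l.
by exists (r \oc c); rewrite -comp_assoc ec comp_assoc rg comp_idl.
Qed.

Lemma triangle_mor_id t :
  triangle_mor (ident (vtx1 t)) (ident (vtx2 t)) (ident (vtx3 t)).
Proof. by split; rewrite ?fmap_id ?comp_idl ?comp_idr. Qed.

Lemma triangle_mor_comp t t' t''
    (f : arrow (vtx1 t) (vtx1 t')) (g : arrow (vtx2 t) (vtx2 t'))
    (h : arrow (vtx3 t) (vtx3 t'))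
    (f' : arrow (vtx1 t') (vtx1 t'')) (g' : arrow (vtx2 t') (vtx2 t''))
    (h' : arrow (vtx3 t') (vtx3 t'')) :
  triangle_mor f' g' h' -> triangle_mor f g h ->
  triangle_mor (f' \oc f) (g' \oc g) (h' \oc h).
Proof.
case=> e1' e2' e3' [e1 e2 e3]; split.
- by rewrite -comp_assoc e1 !comp_assoc e1'.
- by rewrite -comp_assoc e2 !comp_assoc e2'.
- by rewrite fmap_comp -comp_assoc e3 !comp_assoc e3'.
Qed.

Lemma triangle_morD t t' (f f' : arrow (vtx1 t) (vtx1 t'))
    (g g' : arrow (vtx2 t) (vtx2 t')) (h h' : arrow (vtx3 t) (vtx3 t')) :
  triangle_mor f g h -> triangle_mor f' g' h' ->
  triangle_mor (f + f') (g + g') (h + h').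
Proof.
by case=> e1 e2 e3 [e1' e2' e3']; split;
  rewrite ?fmapD compDl compDr ?e1 ?e2 ?e3 ?e1' ?e2' ?e3'.
Qed.

Lemma triangle_morN t t' (f : arrow (vtx1 t) (vtx1 t'))
    (g : arrow (vtx2 t) (vtx2 t')) (h : arrow (vtx3 t) (vtx3 t')) :
  triangle_mor f g h -> triangle_mor (- f) (- g) (- h).
Proof.
by case=> e1 e2 e3; split; rewrite ?fmapN compNl compNr ?e1 ?e2 ?e3.
Qed.

Variable X : add_subcategory T.

Section Transport.
Variables t t' : triangle (@shift T).
Hypotheses (dt : distinguished t) (dt' : distinguished t').

Section Push.
Hypotheses (Lt : left_approximation X (mor1 t)) (Xt' : X (vtx2 t')).

Lemma push_exists (f : arrow (vtx1 t) (vtx1 t')) :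
  exists (h : arrow (vtx3 t) (vtx3 t')) (g : arrow (vtx2 t) (vtx2 t')),
    triangle_mor f g h.
Proof.
have [g eg] := Lt.2 _ Xt' (mor1 t' \oc f).
by have [h mh] := dist_fill dt dt' (esym eg); exists h, g.
Qed.

Lemma push_ideal (f : arrow (vtx1 t) (vtx1 t'))
    (g : arrow (vtx2 t) (vtx2 t')) (h : arrow (vtx3 t) (vtx3 t')) :
  triangle_mor f g h ->
  f \in @ideal _ X (vtx1 t) (vtx1 t') -> h \in @ideal _ X (vtx3 t) (vtx3 t').
Proof.
case=> _ _ e3 /idealP[Z XZ [u [v ef]]].
have [w ew] := Lt.2 _ XZ u.
have [|k /= ->] := @dist_exact (rotate t') _ h ((dist_rotate _).1 dt').
  rewrite /= -e3 ef ew !fmap_comp -!comp_assoc.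
  by rewrite dist_comp13 // !comp0r.
by apply/idealP; exists (vtx2 t') => //; exists k, (mor2 t').
Qed.

(* [f] |-> [h] for any morphism of triangles (f, g, h) : t -> t' *)
Definition push (x : qhom X (vtx1 t) (vtx1 t')) : qhom X (vtx3 t) (vtx3 t') :=
  qpi X (projT1 (cid (push_exists (repr x)))).

Lemma pushE (f : arrow (vtx1 t) (vtx1 t'))
    (g : arrow (vtx2 t) (vtx2 t')) (h : arrow (vtx3 t) (vtx3 t')) :
  triangle_mor f g h -> push (qpi X f) = qpi X h.
Proof.
rewrite /push; case: cid => h' /= [g' m'] m.
apply/qpiP; apply: (push_ideal (triangle_morD m' (triangle_morN m))).
by apply/qpiP; rewrite qpi_repr.
Qed.
End Push.

Section Pull.
Hypotheses (Xt : X (vtx2 t)) (Rt' : right_approximation X (mor2 t')).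

Lemma pull_exists (h : arrow (vtx3 t) (vtx3 t')) :
  exists (f : arrow (vtx1 t) (vtx1 t')) (g : arrow (vtx2 t) (vtx2 t')),
    triangle_mor f g h.
Proof.
have [g eg] := Rt'.2 _ Xt (h \oc mor2 t).
have [c [/= e1]] :=
  dist_fill ((dist_rotate _).1 dt) ((dist_rotate _).1 dt')
    (f := g) (g := h) eg.
have [f ef] := shift_full c; rewrite ef => e2 e3.
exists f, g; split=> //; apply: shift_inj; apply: oppr_inj.
by rewrite !fmap_comp -compNr e3 compNl.
Qed.

Lemma pull_ideal (f : arrow (vtx1 t) (vtx1 t'))
    (g : arrow (vtx2 t) (vtx2 t')) (h : arrow (vtx3 t) (vtx3 t')) :
  triangle_mor f g h ->
  h \in @ideal _ X (vtx3 t) (vtx3 t') -> f \in @ideal _ X (vtx1 t) (vtx1 t').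
Proof.
case=> _ _ e3 /idealP[Z XZ [u [v eh]]].
have [w ew] := Rt'.2 _ XZ v.
have [||l /= el] := @dist_coexact (rotate (rotate t)) _ (fmap shift f).
- exact: ((dist_rotate _).1 ((dist_rotate _).1 dt)).
- by rewrite /= e3 eh ew !comp_assoc dist_comp32 // !comp0l.
have [l' el'] := shift_full l.
have -> : f = - l' \oc mor1 t.
  by apply: shift_inj; rewrite el el' compNr compNl fmapN fmap_comp.
by apply/idealP; exists (vtx2 t) => //; exists (mor1 t), (- l').
Qed.

(* [h] |-> [f] for any morphism of triangles (f, g, h) : t -> t' *)
Definition pull (x : qhom X (vtx3 t) (vtx3 t')) : qhom X (vtx1 t) (vtx1 t') :=
  qpi X (projT1 (cid (pull_exists (repr x)))).

Lemma pullE (f : arrow (vtx1 t) (vtx1 t'))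
    (g : arrow (vtx2 t) (vtx2 t')) (h : arrow (vtx3 t) (vtx3 t')) :
  triangle_mor f g h -> pull (qpi X h) = qpi X f.
Proof.
rewrite /pull; case: cid => f' /= [g' m'] m.
apply/qpiP; apply: (pull_ideal (triangle_morD m' (triangle_morN m))).
by apply/qpiP; rewrite qpi_repr.
Qed.
End Pull.
End Transport.

(* A triangle A -> X_A -> A^+ -> A[1]. *)
Record left_approx_triangle (A : T) := LeftApproxTriangle {
  lapp : T;
  lplus : T;
  lmor1 : arrow A lapp;
  lmor2 : arrow lapp lplus;
  lmor3 : arrow lplus (shift A);
  lapproximation : left_approximation X lmor1;
  ldist : distinguished (Triangle shift lmor1 lmor2 lmor3) }.

(* A triangle A^- -> X^A -> A -> A^-[1]. *)
Record right_approx_triangle (A : T) := RightApproxTriangle {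
  rapp : T;
  rminus : T;
  rmor1 : arrow rminus rapp;
  rmor2 : arrow rapp A;
  rmor3 : arrow A (shift rminus);
  rapproximation : right_approximation X rmor2;
  rdist : distinguished (Triangle shift rmor1 rmor2 rmor3) }.

(* A choice of one such triangle for every object. *)
Definition left_triangles := forall A : T, left_approx_triangle A.
Definition right_triangles := forall A : T, right_approx_triangle A.

Lemma left_triangles_exist : functorially_finite X -> inhabited left_triangles.
Proof.
move=> ffX.
suff H (A : T) : inhabited (left_approx_triangle A).
  by constructor=> A; exact: (projT1 (cid (let: inhabits t := H A in
    ex_intro (fun=> True) t I))).
have [[XA [f Lf]] _] := ffX A.
have [D [g [h d]]] := dist_cone f.
by constructor; exact: LeftApproxTriangle Lf d.
Qed.

Lemma right_triangles_exist :
  functorially_finite X -> inhabited right_triangles.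
Proof.
move=> ffX.
suff H (A : T) : inhabited (right_approx_triangle A).
  by constructor=> A; exact: (projT1 (cid (let: inhabits t := H A in
    ex_intro (fun=> True) t I))).
have [_ [XA [g Rg]]] := ffX A.
have [D' [h' [k' d']]] := dist_cone g.
have [D [s [s' [s's ss']]]] := shift_es D'.
have [f ef] := shift_full (- (k' \oc s)).
suff d : distinguished (Triangle shift f g (s' \oc h')).
  by constructor; exact: RightApproxTriangle Rg d.
apply/dist_rotate; rewrite /rotate /= -ef opprK.
have m : @triangle_mor _ _ (Triangle shift g h' k')
    (Triangle shift g (s' \oc h') (k' \oc s)) (ident XA) (ident A) s'.
  split; rewrite /= ?comp_idl ?comp_idr //.
  by rewrite fmap_id comp_idl -comp_assoc ss' comp_idr.
by apply: (dist_iso m) d' => //; [exists (ident XA)|exists (ident A)|exists s];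
  rewrite ?comp_idl.
Qed.

Section Suspension.
Variable L : left_triangles.

Definition left_triangle (A : T) : triangle (@shift T) :=
  Triangle shift (lmor1 (L A)) (lmor2 (L A)) (lmor3 (L A)).

Lemma left_triangle_mid A : X (vtx2 (left_triangle A)).
Proof. exact: (lapproximation (L A)).1. Qed.

Definition susp_mor (A B : T) :
    qhom X A B -> qhom X (lplus (L A)) (lplus (L B)) :=
  @push (left_triangle A) (left_triangle B)
  (ldist (L A)) (ldist (L B))
    (lapproximation (L A)) (left_triangle_mid B).

Lemma susp_morE A B (f : arrow A B) (g : arrow (lapp (L A)) (lapp (L B)))
    (h : arrow (lplus (L A)) (lplus (L B))) :
  @triangle_mor _ _ (left_triangle A) (left_triangle B) f g h ->
  susp_mor (qpi X f) = qpi X h.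
Proof. exact: pushE. Qed.

Lemma susp_exists A B (f : arrow A B) :
  exists (h : arrow (lplus (L A)) (lplus (L B)))
         (g : arrow (lapp (L A)) (lapp (L B))),
    @triangle_mor _ _ (left_triangle A) (left_triangle B) f g h.
Proof.
exact: (@push_exists (left_triangle A) (left_triangle B)
  (ldist (L A)) (ldist (L B))
  (lapproximation (L A)) (left_triangle_mid B)).
Qed.

Fact susp_id A : susp_mor (qpi X (ident A)) = qpi X (ident (lplus (L A))).
Proof. exact: (susp_morE (triangle_mor_id (left_triangle A))). Qed.

Fact susp_comp A B D (y : qhom X B D) (x : qhom X A B) :
  susp_mor (qcomp y x) = qcomp (susp_mor y) (susp_mor x).
Proof.
rewrite -[x]qpi_repr -[y]qpi_repr qcompE.
have [h [g m]] := susp_exists (repr x).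
have [h' [g' m']] := susp_exists (repr y).
by rewrite (susp_morE m) (susp_morE m') qcompE
  (susp_morE (triangle_mor_comp m' m)).
Qed.

Fact suspD A B (x y : qhom X A B) : susp_mor (x + y) = susp_mor x + susp_mor y.
Proof.
rewrite -[x]qpi_repr -[y]qpi_repr -qpiD.
have [h [g m]] := susp_exists (repr x).
have [h' [g' m']] := susp_exists (repr y).
by rewrite (susp_morE m) (susp_morE m') -qpiD (susp_morE (triangle_morD m m')).
Qed.

Definition suspension : functor (quotient_category X) (quotient_category X) :=
  @Functor (quotient_category X) (quotient_category X)
    (fun A => lplus (L A)) susp_mor susp_id susp_comp suspD.
End Suspension.

Section Loop.
Variable R : right_triangles.

Definition right_triangle (A : T) : triangle (@shift T) :=
  Triangle shift (rmor1 (R A)) (rmor2 (R A)) (rmor3 (R A)).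

Lemma right_triangle_mid A : X (vtx2 (right_triangle A)).
Proof. exact: (rapproximation (R A)).1. Qed.

Definition loop_mor (A B : T) :
    qhom X A B -> qhom X (rminus (R A)) (rminus (R B)) :=
  @pull (right_triangle A) (right_triangle B) (rdist (R A)) (rdist (R B))
    (right_triangle_mid A) (rapproximation (R B)).

Lemma loop_morE A B (h : arrow A B) (g : arrow (rapp (R A)) (rapp (R B)))
    (f : arrow (rminus (R A)) (rminus (R B))) :
  @triangle_mor _ _ (right_triangle A) (right_triangle B) f g h ->
  loop_mor (qpi X h) = qpi X f.
Proof. exact: pullE. Qed.

Lemma loop_exists A B (h : arrow A B) :
  exists (f : arrow (rminus (R A)) (rminus (R B)))
         (g : arrow (rapp (R A)) (rapp (R B))),
    @triangle_mor _ _ (right_triangle A) (right_triangle B) f g h.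
Proof.
exact: (@pull_exists (right_triangle A) (right_triangle B) (rdist (R A))
  (rdist (R B)) (right_triangle_mid A) (rapproximation (R B))).
Qed.

Fact loop_id A : loop_mor (qpi X (ident A)) = qpi X (ident (rminus (R A))).
Proof. exact: (loop_morE (triangle_mor_id (right_triangle A))). Qed.

Fact loop_comp A B D (y : qhom X B D) (x : qhom X A B) :
  loop_mor (qcomp y x) = qcomp (loop_mor y) (loop_mor x).
Proof.
rewrite -[x]qpi_repr -[y]qpi_repr qcompE.
have [h [g m]] := loop_exists (repr x).
have [h' [g' m']] := loop_exists (repr y).
by rewrite (loop_morE m) (loop_morE m') qcompE
  (loop_morE (triangle_mor_comp m' m)).
Qed.

Fact loopD A B (x y : qhom X A B) : loop_mor (x + y) = loop_mor x + loop_mor y.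
Proof.
rewrite -[x]qpi_repr -[y]qpi_repr -qpiD.
have [h [g m]] := loop_exists (repr x).
have [h' [g' m']] := loop_exists (repr y).
by rewrite (loop_morE m) (loop_morE m') -qpiD (loop_morE (triangle_morD m m')).
Qed.

Definition loop : functor (quotient_category X) (quotient_category X) :=
  @Functor (quotient_category X) (quotient_category X)
    (fun A => rminus (R A)) loop_mor loop_id loop_comp loopD.
End Loop.

Section Adjunction.
Variables (L : left_triangles) (R : right_triangles).

Let phi (A B : T) : qhom X (lplus (L A)) B -> qhom X A (rminus (R B)) :=
  @pull (left_triangle L A) (right_triangle R B) (ldist (L A)) (rdist (R B))
    (left_triangle_mid L A) (rapproximation (R B)).

Let psi (A B : T) : qhom X A (rminus (R B)) -> qhom X (lplus (L A)) B :=
  @push (left_triangle L A) (right_triangle R B) (ldist (L A)) (rdist (R B))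
    (lapproximation (L A)) (right_triangle_mid R B).

Let mor A B (f : arrow A (rminus (R B))) g (h : arrow (lplus (L A)) B) :=
  @triangle_mor _ _ (left_triangle L A) (right_triangle R B) f g h.

Let phiE A B (f : arrow A (rminus (R B))) g (h : arrow (lplus (L A)) B) :
  mor f g h -> phi (qpi X h) = qpi X f.
Proof. exact: pullE. Qed.

Let psiE A B (f : arrow A (rminus (R B))) g (h : arrow (lplus (L A)) B) :
  mor f g h -> psi (qpi X f) = qpi X h.
Proof. exact: pushE. Qed.

Let phi_exists A B (h : arrow (lplus (L A)) B) :
  exists (f : arrow A (rminus (R B))) g, mor f g h.
Proof.
exact: (@pull_exists (left_triangle L A) (right_triangle R B) (ldist (L A))
  (rdist (R B)) (left_triangle_mid L A) (rapproximation (R B))).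
Qed.

Let psi_exists A B (f : arrow A (rminus (R B))) :
  exists (h : arrow (lplus (L A)) B) g, mor f g h.
Proof.
exact: (@push_exists (left_triangle L A) (right_triangle R B) (ldist (L A))
  (rdist (R B)) (lapproximation (L A)) (right_triangle_mid R B)).
Qed.

Theorem suspension_loop_adjoint : adjoint (suspension L) (loop R).
Proof.
exists phi; split.
- move=> A B; exists (@psi A B) => x; rewrite -[x]qpi_repr.
  + by have [f [g m]] := phi_exists (repr x); rewrite (phiE m) (psiE m).
  + by have [h [g m]] := psi_exists (repr x); rewrite (psiE m) (phiE m).
- move=> A A' B a x; rewrite -[x]qpi_repr -[a]qpi_repr.
  have [f [g m]] := phi_exists (repr x).
  have [h [k n]] := susp_exists L (repr a).
  rewrite (phiE m) /= (susp_morE n) !qcompE.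
  exact: (phiE (triangle_mor_comp m n)).
- move=> A B B' b x; rewrite -[x]qpi_repr -[b]qpi_repr.
  have [f [g m]] := phi_exists (repr x).
  have [h [k n]] := loop_exists R (repr b).
  rewrite (phiE m) /= (loop_morE n) !qcompE.
  exact: (phiE (triangle_mor_comp n m)).
Qed.
End Adjunction.
End TriangulatedTheory.

(* The suspension and the loop functor of a pretriangulated category; its left
   and right triangles do not enter the definition of n-truncation. *)
Record suspension_loop_category := SuspensionLoopCategory {
  slc_base :> additive;
  slc_susp : functor slc_base slc_base;
  slc_loop : functor slc_base slc_base;
  slc_adjoint : adjoint slc_susp slc_loop }.

Definition truncated (n : nat) (P : suspension_loop_category) : Prop :=
  natural_iso (iter_functor n (slc_susp P)) (zero_functor P).

Definition quotient_suspension_loop (T : triangulated) (X : add_subcategory T)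
    (L : left_triangles X) (R : right_triangles X) : suspension_loop_category :=
  @SuspensionLoopCategory (quotient_category X) (suspension L) (loop R)
    (suspension_loop_adjoint L R).

(* Main.v *)
Require Import Defs.
From mathcomp Require Import all_boot all_algebra.

(** An object dies in the quotient [T/[X]] exactly when it belongs to [X]: if
    its identity factors through an object of [X] it is a retract of that
    object, and in a triangulated category a retract is a direct summand
    ([quotient_nullP], [sub_retract]).  Hence every condition on the powers of
    the suspension and loop functors says which iterated cones [A^(+k)] or
    cocones [A^(-k)] lie in [X], and this is decided by two kinds of dimension
    shifting along the approximation triangles.

    Going down: if [T(Y, A[i]) = 0] for [Y] in [X] and [1 <= i <= n], then
    [A^+] has the same vanishing for [1 <= i <= n-1], because [X] is rigid
    ([right_perp_suspension]).  If moreover [A^+] lies in [X], the connecting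
    morphism [A^+ -> A[1]] vanishes, the triangle splits and [A] lies in [X]
    ([sub_of_suspension]).  Iterating, such an [A] lies in [X] as soon as
    [A^(+n)] does ([sub_of_iter_suspension]); this is the criterion for the
    suspension, and the one for the loop functor is dual.

    Going up: since [A -> X_A] is a left approximation, [A^+] acquires
    [T(A^+, Y[1]) = 0], and inherits [T(A^+, Y[i+1]) = 0] from [T(A, Y[i]) = 0].
    So [A^(+n)] is always left orthogonal to [X[1], ..., X[n]]
    ([left_perp_iter_suspension]); when [X] is cluster tilting this puts it in
    [X], and the n-th power of the suspension is zero.  As that power is left
    adjoint to the n-th power of the loop functor, the two vanish together
    ([null_iter_adjoint]).  When both vanish, the two criteria are the two
    equalities in the definition of a cluster tilting subcategory. *)

Set Implicit Arguments.
Unset Strict Implicit.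
Unset Printing Implicit Defensive.

Import GRing.Theory.
Local Open Scope ring_scope.

(** * Zero objects and zero functors *)

Definition hom_zero (C : preadditive) (A B : C) : Prop :=
  forall f : arrow A B, f = 0.

Lemma null_hom_from (C : preadditive) (A B : C) : ident A = 0 -> hom_zero A B.
Proof. by move=> A0 f; rewrite -[f]comp_idr A0 comp0r. Qed.

Lemma null_hom_to (C : preadditive) (A B : C) : ident B = 0 -> hom_zero A B.
Proof. by move=> B0 f; rewrite -[f]comp_idl B0 comp0l. Qed.

Lemma isomorphic_zobjP (C : Defs.additive) (A : C) :
  isomorphic A zobj <-> ident A = 0.
Proof.
split=> [[f [g [<- _]]]|A0]; first by rewrite [f]hom_to_zobj comp0r.
by exists 0, 0; rewrite !comp0l A0 zobj_id.
Qed.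

Lemma fmap_null (C D : preadditive) (F : functor C D) (A : C) :
  ident A = 0 -> ident (F A) = 0.
Proof. by move=> A0; rewrite -fmap_id A0 fmap0. Qed.

Lemma natural_iso_zeroP (C : Defs.additive) (F : functor C C) :
  natural_iso F (zero_functor C) <-> forall A, ident (F A) = 0.
Proof.
split=> [[eta [isoF _]] A|F0].
  by apply/isomorphic_zobjP; exists (eta A); exact: isoF.
exists (fun=> 0); split=> [A|A B f]; last by rewrite comp0l comp0r.
by exists 0; rewrite !comp0l F0; split=> //; rewrite [RHS]zobj_id.
Qed.

Lemma iter_functor_obj (C : preadditive) (F : functor C C) (n : nat) (A : C) :
  iter_functor n F (F A) = F (iter_functor n F A).
Proof. by elim: n => //= n ->. Qed.

Lemma adjoint_hom_zero (C D : preadditive) (F : functor C D) (G : functor D C)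
    (A : C) (B : D) :
  adjoint F G -> hom_zero (F A) B <-> hom_zero A (G B).
Proof.
case=> phi [bij_phi _ _]; have [psi phiK psiK] := bij_phi A B.
split=> H f.
  by rewrite -[f]psiK -[0]psiK (H (psi f)) (H (psi 0)).
by rewrite -[f]phiK -[0]phiK (H (phi _ _ f)) (H (phi _ _ 0)).
Qed.

Lemma iter_adjoint_hom_zero (C : preadditive) (F G : functor C C) (n : nat)
    (A B : C) :
  adjoint F G ->
  hom_zero (iter_functor n F A) B <-> hom_zero A (iter_functor n G B).
Proof.
move=> adj; elim: n A => [|n IHn] A //=.
by rewrite -iter_functor_obj IHn; exact: adjoint_hom_zero.
Qed.

(** Morphism sets suffice: a functor [F] has only zero objects as values iff
    all [Hom(F A, B)] vanish, and likewise all [Hom(A, G B)] for [G]. *)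
Lemma null_iter_adjoint (C : preadditive) (F G : functor C C) (n : nat) :
  adjoint F G ->
  (forall A, ident (iter_functor n F A) = 0) <->
  (forall A, ident (iter_functor n G A) = 0).
Proof.
move=> adj; split=> H A.
  have [homG _] := iter_adjoint_hom_zero n (iter_functor n G A) A adj.
  exact: (homG (null_hom_from (H _)) (ident _)).
have [_ homF] := iter_adjoint_hom_zero n A (iter_functor n F A) adj.
exact: (homF (null_hom_to (H _)) (ident _)).
Qed.

(** * Retracts and split triangles *)

Lemma dist_exact3 (T : triangulated) (t : triangle (@shift T))
    (dt : distinguished t) (W : T) (k : arrow W (vtx3 t)) :
  mor3 t \oc k = 0 -> exists l : arrow W (vtx2 t), k = mor2 t \oc l.
Proof. exact: (@dist_exact T (rotate t) W k ((dist_rotate t).1 dt)). Qed.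

Lemma dist_coexact3 (T : triangulated) (t : triangle (@shift T))
    (dt : distinguished t) (W : T) (k : arrow (vtx3 t) W) :
  k \oc mor2 t = 0 -> exists l : arrow (shift (vtx1 t)) W, k = l \oc mor3 t.
Proof. exact: (@dist_coexact T (rotate t) W k ((dist_rotate t).1 dt)). Qed.

Lemma dist_coexact1 (T : triangulated) (t : triangle (@shift T))
    (dt : distinguished t) (W : T) (k : arrow (shift (vtx1 t)) W) :
  k \oc mor3 t = 0 ->
  exists l : arrow (shift (vtx2 t)) W, k = l \oc fmap shift (mor1 t).
Proof.
move=> k0; have d := (dist_rotate _).1 ((dist_rotate t).1 dt).
have [l /= ->] := @dist_coexact T (rotate (rotate t)) W k d k0.
by exists (- l); rewrite compNl compNr.
Qed.

Section Retracts.
Variables (T : triangulated) (X : add_subcategory T).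

(** A section [u] has vanishing connecting morphism [h], since [u[1]] is monic
    and kills [h]; so the cone of [u] is a complement of [A] in [Z]. *)
Lemma retract_biproduct (A Z : T) (u : arrow A Z) (v : arrow Z A) :
  v \oc u = ident A -> exists B, biproduct A B Z.
Proof.
move=> vu; have [B [g [h d]]] := dist_cone u.
have gu : g \oc u = 0 := dist_comp21 d.
have h0 : h = 0.
  rewrite -[h]comp_idl -fmap_id -vu fmap_comp -comp_assoc.
  by rewrite (dist_comp13 d) comp0r.
have [|s /= gs] := dist_exact3 d (k := ident B).
  by rewrite /= h0 comp0l.
(* correct the section s of g so that its image lies in the kernel of v *)
pose s' := s - u \oc (v \oc s).
have vs' : v \oc s' = 0 by rewrite compDr compNr comp_assoc vu comp_idl subrr.
have gs' : g \oc s' = ident B.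
  by rewrite compDr compNr comp_assoc gu comp0l subr0.
exists B, u, s', v, g; split=> //.
pose e := ident Z - (u \oc v + s' \oc g).
have [|l /= el] := @dist_exact _ (Triangle shift u g h) Z e d.
  rewrite /= compDr compNr compDr !comp_assoc gu gs'.
  by rewrite comp0l add0r comp_idl comp_idr subrr.
have ve : v \oc e = 0.
  rewrite compDr compNr compDr !comp_assoc vu vs'.
  by rewrite comp0l addr0 comp_idl comp_idr subrr.
have l0 : l = 0 by rewrite -[l]comp_idl -vu -comp_assoc -el ve.
by apply/esym/eqP; rewrite -subr_eq0 -/e el l0 comp0r.
Qed.

Lemma sub_retract (A Z : T) (u : arrow A Z) (v : arrow Z A) :
  v \oc u = ident A -> X Z -> X A.
Proof.
by move=> vu; have [B bip] := retract_biproduct vu; exact: sub_summand bip.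
Qed.

Lemma quotient_nullP (A : T) :
  ident (A : quotient_category X) = 0 <-> X A.
Proof.
split=> [/qpi0P/idealP[Z XZ [u [v /esym vu]]]|XA].
  exact: sub_retract vu XZ.
apply/qpi0P/idealP; exists A => //.
by exists (ident A), (ident A); rewrite comp_idl.
Qed.

Lemma split_mor1 (t : triangle (@shift T)) :
  distinguished t -> mor3 t = 0 -> X (vtx2 t) -> X (vtx1 t).
Proof.
move=> dt t3.
have [|r er] := dist_coexact1 dt (k := ident (shift (vtx1 t))).
  by rewrite t3 comp0r.
have [r' er'] := shift_full r.
apply: (@sub_retract _ _ (mor1 t) r'); apply: shift_inj.
by rewrite fmap_id fmap_comp -er' -er.
Qed.

Lemma split_mor2 (t : triangle (@shift T)) :
  distinguished t -> mor3 t = 0 -> X (vtx2 t) -> X (vtx3 t).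
Proof.
move=> dt t3.
have [|s es] := dist_exact3 dt (k := ident (vtx3 t)).
  by rewrite t3 comp0l.
exact: sub_retract (esym es).
Qed.
End Retracts.

(** * Orthogonality along approximation triangles *)

(** Only the vertices matter for vanishing arguments, so the morphisms of the
    shifted triangle, which carry signs, are left unspecified. *)
Lemma dist_shiftn (T : triangulated) (t : triangle (@shift T)) (i : nat) :
  distinguished t ->
  exists (f : arrow (shiftn T i (vtx1 t)) (shiftn T i (vtx2 t)))
         (g : arrow (shiftn T i (vtx2 t)) (shiftn T i (vtx3 t)))
         (h : arrow (shiftn T i (vtx3 t)) (shift (shiftn T i (vtx1 t)))),
    distinguished (Triangle shift f g h).
Proof.
move=> dt; elim: i => [|i [f [g [h d]]]].
  by exists (mor1 t), (mor2 t), (mor3 t); case: t dt.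
exists (- fmap shift f), (- fmap shift g), (- fmap shift h).
by do 3!move/dist_rotate in d.
Qed.

Section Orthogonality.
Variables (T : triangulated) (X : add_subcategory T).

Definition right_perp (n : nat) (A : T) : Prop :=
  forall Y : T, X Y -> forall i : nat, (1 <= i <= n)%N ->
    hom_zero Y (shiftn T i A).

Definition left_perp (n : nat) (A : T) : Prop :=
  forall Y : T, X Y -> forall i : nat, (1 <= i <= n)%N ->
    hom_zero A (shiftn T i Y).

Variable n : nat.
Hypothesis X_rigid : forall Y, X Y -> left_perp n Y.

Lemma rigid_right_perp (Y : T) : X Y -> right_perp n Y.
Proof. by move=> XY Z XZ i lin; exact: X_rigid. Qed.

Section Suspension.
Variable L : left_triangles X.

(** A morphism [Y -> A^+[i]] is zero after composing to [A[i+1]], so it lifts to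
    [X_A[i]], where rigidity kills it; the shift costs one degree. *)
Lemma right_perp_suspension (m : nat) (A : T) :
  (m < n)%N -> right_perp m.+1 A -> right_perp m (suspension L A).
Proof.
move=> ltmn pA Y XY i /andP[i1 im] k.
have [f [g [h d]]] := dist_shiftn i (ldist (L A)).
have hk : h \oc k = 0 by apply: (pA Y XY i.+1 im).
have [l ->] := dist_exact3 d hk.
rewrite /= (_ : l = 0) ?comp0r //.
apply: (X_rigid XY (left_triangle_mid L A)).
by rewrite i1 (leq_trans im (ltnW ltmn)).
Qed.

(** The hypothesis in degree one kills [A^+ -> A[1]], so [A] is a summand of its
    left approximation. *)
Lemma sub_of_suspension (m : nat) (A : T) :
  right_perp m.+1 A -> X (suspension L A) -> X A.
Proof.
move=> pA XsA.
apply: (split_mor1 (ldist (L A))); last exact: left_triangle_mid.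
exact: (pA _ XsA 1%N).
Qed.

Lemma sub_of_iter_suspension (A : T) :
  right_perp n A -> X (iter_functor n (suspension L) A) -> X A.
Proof.
move=> pA.
have pk k : (k <= n)%N -> right_perp (n - k) (iter_functor k (suspension L) A).
  elim: k => [|k IHk] ltkn; first by rewrite subn0.
  apply: right_perp_suspension; first by rewrite ltn_subrL (leq_trans _ ltkn).
  by rewrite -subSn // subSS; apply: IHk; exact: ltnW.
have: (n <= n)%N by [].
elim: {1 3}n => [//|k IHk] ltkn XsA; apply: IHk (ltnW ltkn) _.
apply: (@sub_of_suspension (n - k.+1)) XsA.
by rewrite -subSn // subSS; exact/pk/ltnW.
Qed.

(** A morphism [A^+ -> Y[i+1]] vanishes on [X_A] by rigidity, so it factors
    through [A[1]], that is, it comes from a morphism [A -> Y[i]]. *)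
Lemma left_perp_suspension (m : nat) (A : T) :
  (m < n)%N -> left_perp m A -> left_perp m.+1 (suspension L A).
Proof.
move=> ltmn pA Y XY [//|i] /= im f.
have f2 : f \oc lmor2 (L A) = 0.
  apply: (X_rigid (left_triangle_mid L A) XY (i := i.+1)).
  by rewrite (leq_trans im ltmn).
have [l /= ->] := dist_coexact3 (ldist (L A)) f2.
have [l' ->] := shift_full l.
case: i => [|i] in im f f2 l l' *.
  (* in degree one, l' : A -> Y need not vanish, but it extends along the left
     approximation of A *)
  have [h ->] := (lapproximation (L A)).2 _ XY l'.
  by rewrite fmap_comp -comp_assoc (dist_comp13 (ldist (L A))) comp0r.
by rewrite (_ : l' = 0) ?fmap0 ?comp0l //; apply: (pA Y XY i.+1).
Qed.

Lemma left_perp_iter_suspension (A : T) :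
  left_perp n (iter_functor n (suspension L) A).
Proof.
have: (n <= n)%N by [].
elim: {1 3 4}n => [_ Y _ [|i] //|k IHk ltkn].
by apply: left_perp_suspension => //; exact/IHk/ltnW.
Qed.
End Suspension.

Section Loop.
Variable R : right_triangles X.

(** Shifted once, a morphism [A^- -> Y[i]] restricts along [A -> A^-[1]] to a
    morphism [A -> Y[i+1]], which is zero; so it extends to [X^A], where rigidity
    kills it. *)
Lemma left_perp_loop (m : nat) (A : T) :
  (m < n)%N -> left_perp m.+1 A -> left_perp m (loop R A).
Proof.
move=> ltmn pA Y XY i /andP[i1 im] f.
have f3 : fmap shift f \oc rmor3 (R A) = 0.
  by apply: (pA Y XY i.+1 im).
have [l /= el] := dist_coexact1 (rdist (R A)) f3.
have [l' el'] := shift_full l.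
apply: shift_inj; rewrite fmap0 el el' (_ : l' = 0) ?fmap0 ?comp0l //.
apply: (X_rigid (right_triangle_mid R A) XY).
by rewrite i1 (leq_trans im (ltnW ltmn)).
Qed.

Lemma sub_of_loop (m : nat) (A : T) :
  left_perp m.+1 A -> X (loop R A) -> X A.
Proof.
move=> pA XlA.
apply: (split_mor2 (rdist (R A))); last exact: right_triangle_mid.
exact: (pA _ XlA 1%N).
Qed.

Lemma sub_of_iter_loop (A : T) :
  left_perp n A -> X (iter_functor n (loop R) A) -> X A.
Proof.
move=> pA.
have pk k : (k <= n)%N -> left_perp (n - k) (iter_functor k (loop R) A).
  elim: k => [|k IHk] ltkn; first by rewrite subn0.
  apply: left_perp_loop; first by rewrite ltn_subrL (leq_trans _ ltkn).
  by rewrite -subSn // subSS; apply: IHk; exact: ltnW.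
have: (n <= n)%N by [].
elim: {1 3}n => [//|k IHk] ltkn XlA; apply: IHk (ltnW ltkn) _.
apply: (@sub_of_loop (n - k.+1)) XlA.
by rewrite -subSn // subSS; exact/pk/ltnW.
Qed.
End Loop.

Lemma sub_suspensionP (L : left_triangles X) (A : T) :
  X A <-> right_perp n A /\
    isomorphic (iter_functor n (suspension L) (quotient_functor X A)) zobj.
Proof.
split=> [XA|[pA /isomorphic_zobjP/quotient_nullP]]; last first.
  exact: sub_of_iter_suspension.
split; first exact: rigid_right_perp.
by apply/isomorphic_zobjP/fmap_null/quotient_nullP.
Qed.

Lemma sub_loopP (R : right_triangles X) (A : T) :
  X A <-> left_perp n A /\
    isomorphic (iter_functor n (loop R) (quotient_functor X A)) zobj.
Proof.
split=> [XA|[pA /isomorphic_zobjP/quotient_nullP]]; last first.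
  exact: sub_of_iter_loop.
split; first exact: X_rigid.
by apply/isomorphic_zobjP/fmap_null/quotient_nullP.
Qed.
End Orthogonality.

(** * The equivalence *)

Theorem corollary3p12 (n : nat) (n_ge1 : (1 <= n)%N)
    (T : triangulated) (X : add_subcategory T)
    (X_ff : functorially_finite X)
    (X_rigid : forall Y Y' : T, X Y -> X Y' ->
       forall i : nat, (1 <= i <= n)%N ->
       forall f : arrow Y (shiftn T i Y'), f = 0)
    (L : left_triangles X) (R : right_triangles X) :
  [/\ [<-> cluster_tilting n.+1 X;
           truncated n (quotient_suspension_loop L R);
           natural_iso (iter_functor n (suspension L))
             (zero_functor (quotient_category X));
           natural_iso (iter_functor n (loop R))
             (zero_functor (quotient_category X))],
      forall A : T,
        X A <->
        (forall Y : T, X Y -> forall i : nat, (1 <= i <= n)%N ->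
           forall f : arrow Y (shiftn T i A), f = 0) /\
        isomorphic
          (iter_functor n (suspension L) (quotient_functor X A)) zobj
    & forall A : T,
        X A <->
        (forall Y : T, X Y -> forall i : nat, (1 <= i <= n)%N ->
           forall f : arrow A (shiftn T i Y), f = 0) /\
        isomorphic
          (iter_functor n (loop R) (quotient_functor X A)) zobj].
Proof.
have rigid (Y : T) : X Y -> left_perp X n Y by move=> XY Z; exact: X_rigid.
have suspP := sub_suspensionP rigid L; have loopP := sub_loopP rigid R.
have adj := null_iter_adjoint n (suspension_loop_adjoint L R).
split=> //.
tfae=> [[_ leftP _]|//|/natural_iso_zeroP/adj ?|/natural_iso_zeroP O0].
- apply/natural_iso_zeroP => A; apply/quotient_nullP/leftP.
  exact: left_perp_iter_suspension.
- exact/natural_iso_zeroP.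
have S0 := adj.2 O0; split=> // A.
  split=> [XA|pA]; first exact: rigid.
  by apply/loopP; split=> //; exact/isomorphic_zobjP.
split=> [XA|pA]; first exact: rigid_right_perp.
by apply/suspP; split=> //; exact/isomorphic_zobjP.
Qed.
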